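(* Let $\mathbf M^{(2)}$ denote the generic two-dimensional Eshelby tensor, i.e. a real fourth order tensor in dimension two with $M_{ijkl}=M_{jikl}=M_{ijlk}$, with irreducible decomposition into three scalars $\lambda,\mu,v$, two second order irreducible tensors $\mathbf D^1,\mathbf D^2$ and one fourth order irreducible tensor $\mathbf D$ (as recalled in the context). Define (summation over repeated indices) $$J_1:=D^1_{ij}D^1_{ij},\quad J_2:=D^2_{ij}D^2_{ij},\quad J_3:=D_{ijkl}D_{ijkl},\quad J_4:=D^1_{ij}D_{ijkl}D^1_{kl},\quad J_5:=D^2_{ij}D_{ijkl}D^2_{kl},$$ $$J_6:=D^1_{ij}D^2_{ij},\quad J_7:=D^1_{ij}D_{ijkl}D^2_{kl},\quad J_8:=\lambda,\quad J_9:=\mu,\quad J_{10}:=v.$$ Then $J_1,\ldots,J_{10}$ are functionally irreducible, i.e. for every $s\in\{1,\ldots,10\}$, $J_s$ is not a (single-valued) function of the other nine: there exist two such tensors $M,M'$ with $J_t(M)=J_t(M')$ for all $t\ne s$ but $J_s(M)\neq J_s(M')$.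
   Context: All indices run over $\{1,2\}$, repeated indices are summed, $\delta_{ij}$ is the Kronecker delta, and $\epsilon_{ij}$ is the permutation symbol ($\epsilon_{12}=1=-\epsilon_{21}$, $\epsilon_{11}=\epsilon_{22}=0$). Let $V$ be the real vector space of tensors $M_{ijkl}$ with $M_{ijkl}=M_{jikl}=M_{ijlk}$ (two-dimensional Eshelby tensors). A tensor is irreducible if it is totally symmetric and traceless. Irreducible decomposition. Each $M\in V$ is written uniquely as $$M_{ijkl}=\lambda\delta_{ij}\delta_{kl}+\mu(\delta_{ik}\delta_{jl}+\delta_{il}\delta_{jk})+\tfrac{v}{2}(\delta_{ik}\epsilon_{jl}+\delta_{il}\epsilon_{jk}+\delta_{jk}\epsilon_{il}+\delta_{jl}\epsilon_{ik})+\delta_{ij}D^1_{kl}+\delta_{kl}D^2_{ij}+D_{ijkl},$$ where $\lambda=\frac38M_{iikk}-\frac14M_{ikik}$, $\mu=\frac14M_{ikik}-\frac18M_{iikk}$, $v=\frac14\epsilon_{ij}M_{ikjk}$ are scalars, $D^1_{ij}=\frac12M_{kkij}-\frac14M_{kkll}\delta_{ij}$ and $D^2_{ij}=\frac12M_{ijkk}-\frac14M_{kkll}\delta_{ij}$ are second order irreducible tensors, and $D_{ijkl}$, defined as the remainder, is a fourth order irreducible tensor. This identifies $V$ with the space of all tuples $(\lambda,\mu,v,\mathbf D^1,\mathbf D^2,\mathbf D)$ with $\lambda,\mu,v\in\mathbb R$, $\mathbf D^1,\mathbf D^2$ second order irreducible and $\mathbf D$ fourth order irreducible. *)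

(* Defs.v *)
From mathcomp Require Import all_boot all_order all_algebra reals.

Set Implicit Arguments.
Unset Strict Implicit.
Unset Printing Implicit Defensive.

Import Order.TTheory GRing.Theory Num.Theory.

Local Open Scope ring_scope.

(* Indices range over 'I_2 = {0, 1} instead of {1, 2}. *)
Definition tensor2 (R : Type) := 'I_2 -> 'I_2 -> R.
Definition tensor4 (R : Type) := 'I_2 -> 'I_2 -> 'I_2 -> 'I_2 -> R.

Definition eshelby (R : Type) (M : tensor4 R) : Prop :=
  forall i j k l, M i j k l = M j i k l /\ M i j k l = M i j l k.

Section Decomposition.
Variable R : realType.

Definition kron : tensor2 R := fun i j => (i == j)%:R.
Definition eps : tensor2 R := fun i j => (i < j)%N%:R - (j < i)%N%:R.

Variable M : tensor4 R.

Definition tr_iikk : R := \sum_i \sum_k M i i k k.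
Definition tr_ikik : R := \sum_i \sum_k M i k i k.

Definition lam : R := 3 / 8 * tr_iikk - 1 / 4 * tr_ikik.
Definition mu : R := 1 / 4 * tr_ikik - 1 / 8 * tr_iikk.
Definition vee : R := 1 / 4 * \sum_i \sum_j \sum_k eps i j * M i k j k.

Definition dev1 : tensor2 R := fun i j =>
  1 / 2 * (\sum_k M k k i j) - 1 / 4 * tr_iikk * kron i j.
Definition dev2 : tensor2 R := fun i j =>
  1 / 2 * (\sum_k M i j k k) - 1 / 4 * tr_iikk * kron i j.

(* The fourth order irreducible part, as the remainder of the decomposition. *)
Definition dev4 : tensor4 R := fun i j k l =>
  M i j k l -
  (lam * (kron i j * kron k l)
   + mu * (kron i k * kron j l + kron i l * kron j k)
   + vee / 2 * (kron i k * eps j l + kron i l * eps j k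
                + kron j k * eps i l + kron j l * eps i k)
   + kron i j * dev1 k l
   + kron k l * dev2 i j).

End Decomposition.

Section Invariants.
Variable R : realType.

Definition dot2 (A B : tensor2 R) : R := \sum_i \sum_j A i j * B i j.
Definition dot4 (A B : tensor4 R) : R :=
  \sum_i \sum_j \sum_k \sum_l A i j k l * B i j k l.
Definition form4 (A : tensor2 R) (D : tensor4 R) (B : tensor2 R) : R :=
  \sum_i \sum_j \sum_k \sum_l A i j * D i j k l * B k l.

(* J_s is the entry of index s - 1. *)
Definition invariants (M : tensor4 R) : 10.-tuple R :=
  [tuple dot2 (dev1 M) (dev1 M);
         dot2 (dev2 M) (dev2 M);
         dot4 (dev4 M) (dev4 M);
         form4 (dev1 M) (dev4 M) (dev1 M);
         form4 (dev2 M) (dev4 M) (dev2 M);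
         dot2 (dev1 M) (dev2 M);
         form4 (dev1 M) (dev4 M) (dev2 M);
         lam M;
         mu M;
         vee M].

End Invariants.

(* Main.v *)
(* Identify the irreducible tensors D^1, D^2, D with complex numbers z1, z2, w
   through their independent components (D_11, D_12) and (D_1111, D_1112). Then
   J1, J2, J3 are multiples of |z1|^2, |z2|^2, |w|^2, J6 is 2 Re (z1 z2^* ),
   and J4, J5, J7 are 4 Re (w^* z1^2), 4 Re (w^* z2^2), 4 Re (w^* z1 z2).
   Small integral values of (z1, z2, w) then separate each J_s; the only
   nonobvious one is J7, with w = 1, z1 = 1 + i and z2 = 1 - i or -1 + i. *)
Require Import Defs.
From mathcomp Require Import all_boot all_order all_algebra reals.
From mathcomp Require Import ring lra.

Set Implicit Arguments.
Unset Strict Implicit.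
Unset Printing Implicit Defensive.

Import Order.TTheory GRing.Theory Num.Theory.

Local Open Scope ring_scope.

(* The component of an irreducible tensor depends only on the number n of its
   indices equal to 2, and tracelessness gives it period 4 up to sign: it is
   a, b, -a, -b, a, ... for n = 0, 1, 2, 3, 4, ... *)
Definition harmonic (R : realType) (a b : R) (n : nat) : R :=
  (-1) ^+ n./2 * (if odd n then b else a).

Definition irr2 (R : realType) (a b : R) : tensor2 R :=
  fun i j => harmonic a b (i + j).

Definition irr4 (R : realType) (p q : R) : tensor4 R :=
  fun i j k l => harmonic p q (i + j + k + l).

Definition recompose (R : realType) (x y z a b c d p q : R) : tensor4 R :=
  fun i j k l =>
  x * (kron R i j * kron R k l)
  + y * (kron R i k * kron R j l + kron R i l * kron R j k)
  + z / 2 * (kron R i k * eps R j l + kron R i l * eps R j k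
             + kron R j k * eps R i l + kron R j l * eps R i k)
  + kron R i j * irr2 a b k l
  + kron R k l * irr2 c d i j
  + irr4 p q i j k l.

Lemma ord2P (P : 'I_2 -> Prop) : P ord0 -> P (lift ord0 ord0) -> forall i, P i.
Proof.
move=> P0 P1 i; case: (unliftP ord0 i) => [j|] -> //.
by rewrite (ord1 j).
Qed.

Section Recompose.
Variables (R : realType) (x y z a b c d p q : R).
Let M : tensor4 R := recompose x y z a b c d p q.

Lemma eshelby_recompose : eshelby M.
Proof.
move=> i j k l; rewrite /M /recompose /irr2 /irr4 /harmonic /kron /eps.
by split; move: i j k l; do 4!apply: ord2P; rewrite /=; ring.
Qed.

(** Only the two isotropic terms survive: [irr2] and [irr4] are traceless, and the [eps] terms
    cancel by antisymmetry. *)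
Lemma tr_iikk_recompose : tr_iikk M = 4 * x + 4 * y.
Proof.
rewrite /tr_iikk !big_ord_recl !big_ord0.
by rewrite /M /recompose /irr2 /irr4 /harmonic /kron /eps /=; field.
Qed.

Lemma tr_ikik_recompose : tr_ikik M = 2 * x + 6 * y.
Proof.
rewrite /tr_ikik !big_ord_recl !big_ord0.
by rewrite /M /recompose /irr2 /irr4 /harmonic /kron /eps /=; field.
Qed.

Lemma lam_recompose : lam M = x.
Proof. by rewrite /lam tr_iikk_recompose tr_ikik_recompose; field. Qed.

Lemma mu_recompose : mu M = y.
Proof. by rewrite /mu tr_iikk_recompose tr_ikik_recompose; field. Qed.

Lemma vee_recompose : vee M = z.
Proof.
rewrite /vee !big_ord_recl !big_ord0.
by rewrite /M /recompose /irr2 /irr4 /harmonic /kron /eps /=; field.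
Qed.

Lemma dev1_recompose i j : dev1 M i j = irr2 a b i j.
Proof.
rewrite /dev1 tr_iikk_recompose !big_ord_recl big_ord0.
rewrite /M /recompose /irr2 /irr4 /harmonic /kron /eps.
by move: i j; do 2!apply: ord2P; rewrite /=; field.
Qed.

Lemma dev2_recompose i j : dev2 M i j = irr2 c d i j.
Proof.
rewrite /dev2 tr_iikk_recompose !big_ord_recl big_ord0.
rewrite /M /recompose /irr2 /irr4 /harmonic /kron /eps.
by move: i j; do 2!apply: ord2P; rewrite /=; field.
Qed.

(** Since [dev4] is a remainder, it suffices that the other five parts are recovered exactly. *)
Lemma dev4_recompose i j k l : dev4 M i j k l = irr4 p q i j k l.
Proof.
rewrite /dev4 lam_recompose mu_recompose vee_recompose.
rewrite dev1_recompose dev2_recompose /M /recompose.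
by rewrite [X in X - _]addrC addrK.
Qed.

(** The factors 2 and 8 are multiplicities: up to sign, two components of [irr2 a b] are [a] and two
    are [b]; eight of [irr4 p q] are [p] and eight are [q]. *)
Lemma invariants_recompose :
  invariants M =
    [tuple 2 * (a ^+ 2 + b ^+ 2);
           2 * (c ^+ 2 + d ^+ 2);
           8 * (p ^+ 2 + q ^+ 2);
           4 * (p * (a ^+ 2 - b ^+ 2) + 2 * q * a * b);
           4 * (p * (c ^+ 2 - d ^+ 2) + 2 * q * c * d);
           2 * (a * c + b * d);
           4 * (p * (a * c - b * d) + q * (a * d + b * c));
           x; y; z].
Proof.
apply/val_inj; rewrite /= lam_recompose mu_recompose vee_recompose.
rewrite /dot2 /dot4 /form4 !big_ord_recl !big_ord0.
rewrite !(dev1_recompose, dev2_recompose, dev4_recompose).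
by rewrite /irr2 /irr4 /harmonic /=; do ![congr (_ :: _); first by ring].
Qed.

End Recompose.

Theorem proposition4p2 (R : realType) (s : 'I_10) :
  exists M M' : tensor4 R,
    [/\ eshelby M, eshelby M',
        (forall t : 'I_10, t != s ->
           tnth (invariants M) t = tnth (invariants M') t)
      & tnth (invariants M) s <> tnth (invariants M') s].
Proof.
have separate (x y z a b c d p q x' y' z' a' b' c' d' p' q' : R) :
    let J := invariants (recompose x y z a b c d p q) in
    let J' := invariants (recompose x' y' z' a' b' c' d' p' q') in
    (forall t, t != s -> tnth J t = tnth J' t) -> tnth J s <> tnth J' s ->
    exists M M' : tensor4 R,
      [/\ eshelby M, eshelby M',
          (forall t : 'I_10, t != s ->
             tnth (invariants M) t = tnth (invariants M') t)
        & tnth (invariants M) s <> tnth (invariants M') s].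
  move=> J J' eqJ neqJ.
  exists (recompose x y z a b c d p q), (recompose x' y' z' a' b' c' d' p' q').
  by split=> //; apply: eshelby_recompose.
case: s separate => [[|[|[|[|[|[|[|[|[|[|//]]]]]]]]]] lt_s] separate;
  [ apply: (separate 0 0 0 1 0 0 0 0 0  0 0 0 0 0 0 0 0 0)
  | apply: (separate 0 0 0 0 0 1 0 0 0  0 0 0 0 0 0 0 0 0)
  | apply: (separate 0 0 0 0 0 0 0 1 0  0 0 0 0 0 0 0 0 0)
  (* Passing from z1 = 1 to z1 = i keeps |z1| but negates z1^2; z2 = 0 kills J5, J6 and J7. *)
  | apply: (separate 0 0 0 1 0 0 0 1 0  0 0 0 0 1 0 0 1 0)
  | apply: (separate 0 0 0 0 0 1 0 1 0  0 0 0 0 0 0 1 1 0)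
  (* Negating z2 flips J6 and J7 only, and w = 0 kills J7. *)
  | apply: (separate 0 0 0 1 0 1 0 0 0  0 0 0 1 0 (-1) 0 0 0)
  (* Again z2 is negated: now z1 and z2 are orthogonal, so J6 = 0, while z1 z2 = 2 or -2 is real, so
     J7 changes sign. *)
  | apply: (separate 0 0 0 1 1 1 (-1) 1 0  0 0 0 1 1 (-1) 1 1 0)
  | apply: (separate 1 0 0 0 0 0 0 0 0  0 0 0 0 0 0 0 0 0)
  | apply: (separate 0 1 0 0 0 0 0 0 0  0 0 0 0 0 0 0 0 0)
  | apply: (separate 0 0 1 0 0 0 0 0 0  0 0 0 0 0 0 0 0 0) ].
all: rewrite !invariants_recompose; try by rewrite !(tnth_nth 0) /=; lra.
(* The inequalities at [s] are settled; in the agreements left, the case [t = s] has a false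
   hypothesis. *)
all: case=> [[|[|[|[|[|[|[|[|[|[|//]]]]]]]]]] lt_t] //= _.
all: by rewrite !(tnth_nth 0) /=; ring.
Qed.
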